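(* Let $C\subseteq\omega$ be an infinite computable set and let $A\subseteq\omega$ have intrinsic density $r$. Then $A\triangleleft C$ has intrinsic density $r$.
   Context: For $S\subseteq\omega$ write $S=\{s_0<s_1<s_2<\cdots\}$. The set $A\triangleleft C$ (''$A$ within $C$'') is $\{n : c_n\in A\}$. For $S\subseteq\omega$, $\rho_n(S)=|S\cap\{0,\dots,n-1\}|/n$ and $\rho(S)=\lim_n\rho_n(S)$ when it exists; $S$ has intrinsic density $r$ if $\rho(\pi(S))=r$ for every computable permutation $\pi$ of $\omega$. *)

(* Defs.v *)
From HB Require Import structures.
From mathcomp Require Import all_boot all_order all_algebra.
From mathcomp Require Import all_classical all_reals all_analysis.

Set Implicit Arguments.
Unset Strict Implicit.
Unset Printing Implicit Defensive.

Import Order.TTheory GRing.Theory Num.Theory.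
Import numFieldNormedType.Exports.

Local Open Scope classical_set_scope.

(* Codes of k-ary partial recursive functions. *)
Inductive recfun : nat -> Type :=
| Zero k : recfun k
| Succ : recfun 1
| Proj k (i : 'I_k) : recfun k
| Comp k m (f : recfun m) (g : 'I_m -> recfun k) : recfun k
| PrimRec k (f : recfun k) (g : recfun k.+2) : recfun k.+1
| Mu k (f : recfun k.+1) : recfun k.

Fixpoint primrec k (F : k.-tuple nat -> nat -> Prop)
    (G : k.+2.-tuple nat -> nat -> Prop)
    (n : nat) (v : k.-tuple nat) (y : nat) : Prop :=
  if n is m.+1 then
    exists2 z, primrec F G m v z & G [tuple of [:: m, z & v]] y
  else F v y.

(* [rec_eval c v y]: the function coded by [c] is defined at [v], with value [y]. *)
Fixpoint rec_eval k (c : recfun k) : k.-tuple nat -> nat -> Prop :=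
  match c in recfun k return k.-tuple nat -> nat -> Prop with
  | Zero _ => fun _ y => y = 0
  | Succ => fun v y => y = (thead v).+1
  | Proj _ i => fun v y => y = tnth v i
  | Comp _ m f g => fun v y =>
      exists2 w : m.-tuple nat, forall i, rec_eval (g i) v (tnth w i) & rec_eval f w y
  | PrimRec _ f g => fun v y =>
      primrec (rec_eval f) (rec_eval g) (thead v) (behead_tuple v) y
  | Mu _ f => fun v y =>
      rec_eval f [tuple of y :: v] 0 /\
      forall i, i < y -> exists2 z, 0 < z & rec_eval f [tuple of i :: v] z
  end.

Lemma rec_eval_functional k (c : recfun k) (v : k.-tuple nat) (y z : nat) :
  rec_eval c v y -> rec_eval c v z -> y = z.
Proof.
elim: c v y z => {k} [k|| k i| k m f IHf g IHg| k f IHf g IHg| k f IHf] v y z /=.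
- by move=> -> ->.
- by move=> -> ->.
- by move=> -> ->.
- move=> [w gw fw] [w' gw' fw'].
  suff ww' : w = w' by rewrite -ww' in fw'; exact: IHf fw fw'.
  by apply: eq_from_tnth => i; exact: IHg (gw i) (gw' i).
- elim: (thead v) y z => [|n IHn] y z /=; first exact: IHf.
  move=> [a na ga] [b nb gb].
  by rewrite -(IHn _ _ na nb) in gb; exact: IHg ga gb.
- move=> [fy ly] [fz lz]; case: (ltngtP y z) => // [/lz|/ly] [x x0 fx].
    by rewrite (IHf _ _ _ fx fy) in x0.
  by rewrite (IHf _ _ _ fx fz) in x0.
Qed.

Definition computable (f : nat -> nat) : Prop :=
  exists c : recfun 1, forall n, rec_eval c [tuple n] (f n).

Definition computable_set (S : set nat) : Prop :=
  computable (fun n => nat_of_bool `[< S n >]).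

Definition computable_permutation (p : nat -> nat) : Prop :=
  bijective p /\ computable p.

Definition is_least (S : set nat) (s : nat) : Prop :=
  S s /\ forall x, S x -> s <= x.

(* [is_nth S n s]: s = s_n, where S = {s_0 < s_1 < s_2 < ...}. *)
Fixpoint is_nth (S : set nat) (n s : nat) : Prop :=
  if n is m.+1 then
    exists2 t, is_nth S m t & is_least [set x | S x /\ t < x] s
  else is_least S s.

(* The set A ◁ C. *)
Definition set_within (A C : set nat) : set nat :=
  [set n | exists2 c, is_nth C n c & A c].

Local Open Scope ring_scope.

(* At n = 0 this is 0 / 0 = 0, which plays no role in the limit. *)
Definition rho_n (R : realType) (S : set nat) (n : nat) : R :=
  #|[pred i : 'I_n | `[< S i >]]|%:R / n%:R.

Definition has_density (R : realType) (S : set nat) (r : R) : Prop :=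
  rho_n R S n @[n --> \oo] --> r.

Definition has_intrinsic_density (R : realType) (S : set nat) (r : R) : Prop :=
  forall p : nat -> nat, computable_permutation p -> has_density (p @` S) r.

(* Main.v *)
(** Let [p] be a computable permutation and let [h] send [p n] to the [n]-th
    element of [C]. Then [h] is a computable injection and the image of [A] within
    [C] under [p] is the preimage of [A] under [h]. Extend [h] greedily to a
    computable bijection [g]: at a perfect square stage [g] takes the least unused
    number, at every other stage the first unused value of [h]. Since the [j]
    chosen at stage [m] satisfies [j <= m], the sets [g[0,n)] and [h[0,n)] differ
    by at most the number of squares below [n], which is [o(n)]. So the preimages
    of [A] under [g] and [h] have the same density, and that under [g] is the image
    of [A] under the computable permutation [g^-1], of density [r]. *)

Require Import Defs.
From mathcomp Require Import all_boot all_order all_algebra.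
From mathcomp Require Import all_classical all_reals all_analysis.
From mathcomp Require Import zify.

Set Implicit Arguments.
Unset Strict Implicit.
Unset Printing Implicit Defensive.

Import Order.TTheory GRing.Theory Num.Theory.
Import numFieldNormedType.Exports.

Local Open Scope classical_set_scope.

(** * Closure properties of total recursive functions *)

(* Only the values of [F] on lists of length [k] matter. *)
Definition recursive k (F : seq nat -> nat) : Prop :=
  exists c : recfun k, forall v : k.-tuple nat, rec_eval c v (F v).

Lemma recursive_ext k F G : recursive k F -> F =1 G -> recursive k G.
Proof. by move=> [c cF] FG; exists c => v; rewrite -FG. Qed.

Lemma recursive_nth k i : i < k -> recursive k (fun v => nth 0 v i).
Proof. by move=> ik; exists (Proj (Ordinal ik)) => v /=; rewrite (tnth_nth 0). Qed.

Lemma recursive1P f : computable f <-> recursive 1 (fun v => f (nth 0 v 0)).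
Proof.
split=> -[c cf]; exists c; last by move=> n; exact: (cf [tuple n]).
by case/tupleP=> x v; rewrite tuple0; exact: cf.
Qed.

Lemma recursive_comp1 k f F :
  recursive 1 (fun v => f (nth 0 v 0)) -> recursive k F ->
  recursive k (fun v => f (F v)).
Proof.
move=> [c cf] [d dF]; exists (Comp c (fun=> d)) => v /=.
by exists [tuple F v] => [i|]; [rewrite ord1; exact: dF|exact: cf].
Qed.

Lemma recursive_comp2 k f F G :
  recursive 2 (fun v => f (nth 0 v 0) (nth 0 v 1)) ->
  recursive k F -> recursive k G ->
  recursive k (fun v => f (F v) (G v)).
Proof.
move=> [c cf] [d dF] [e eG].
exists (Comp c (fun i : 'I_2 => if val i == 0 then d else e)) => v /=.
exists [tuple F v; G v]; last exact: cf.
by case=> [[|[|//]] i2]; [exact: dF|exact: eG].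
Qed.

Lemma recursive_const k n : recursive k (fun=> n).
Proof.
elim: n => [|n IHn]; first by exists (Zero k).
by apply: recursive_comp1 IHn; exists Succ => v; case/tupleP: v.
Qed.

Lemma recursive_succ k F : recursive k F -> recursive k (fun v => (F v).+1).
Proof. by apply: recursive_comp1; exists Succ => v; case/tupleP: v. Qed.

(** In the step function, index 0 is the counter, index 1 the accumulated value, and the parameters
    start at index 2. *)
Lemma recursive_rec k N F G :
  recursive k N -> recursive k F -> recursive k.+2 G ->
  recursive k (fun v => nat_rec _ (F v) (fun m z => G [:: m, z & v]) (N v)).
Proof.
move=> [cN cNE] [cF cFE] [cG cGE].
(* The composition puts [N v] in front of the parameters: [unlift] separates position 0, filled by
   [cN], from the projections. *)
exists (Comp (PrimRec cF cG)
  (fun i : 'I_k.+1 => if unlift ord0 i is Some j then Proj j else cN)) => v /=.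
exists [tuple of N v :: v].
  move=> i; case: unliftP => [j ->|->] /=; first by rewrite tnthS.
  exact: cNE.
have -> : behead_tuple [tuple of N v :: v] = v by exact: val_inj.
rewrite theadE; elim: (N v) => [|n IHn] /=; first exact: cFE.
by eexists; [exact: IHn|exact: (cGE [tuple of [:: n, _ & v]])].
Qed.

(** The result [M] is given in advance with its minimality, so the unbounded search is known to
    stop. The search is for a zero, hence a boolean test is passed negated. *)
Lemma recursive_mu k P M :
  recursive k.+1 P -> (forall v, P (M v :: v) = 0) ->
  (forall v i, i < M v -> 0 < P (i :: v)) -> recursive k M.
Proof.
move=> [c cP] PM Pi; exists (Mu c) => v /=; split.
  by rewrite -(PM v); exact: (cP [tuple of M v :: v]).
by move=> i /Pi iP; exists (P (i :: v)) => //; exact: (cP [tuple of i :: v]).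
Qed.

Lemma recursive_add k F G :
  recursive k F -> recursive k G -> recursive k (fun v => F v + G v).
Proof.
apply: (@recursive_comp2 _ addn).
apply: recursive_ext (recursive_rec (@recursive_nth 2 0 isT)
  (@recursive_nth 2 1 isT) (recursive_succ (@recursive_nth 4 1 isT))) _ => v /=.
by elim: (nth 0 v 0) => [|n IHn] //=; rewrite IHn addSn.
Qed.

Lemma recursive_mul k F G :
  recursive k F -> recursive k G -> recursive k (fun v => F v * G v).
Proof.
apply: (@recursive_comp2 _ muln).
apply: recursive_ext (recursive_rec (@recursive_nth 2 0 isT)
  (@recursive_const 2 0) (recursive_add (@recursive_nth 4 1 isT)
  (@recursive_nth 4 3 isT))) _ => v /=.
by elim: (nth 0 v 0) => [|n IHn] //=; rewrite IHn mulSn addnC.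
Qed.

Lemma recursive_pred k F : recursive k F -> recursive k (fun v => (F v).-1).
Proof.
apply: (@recursive_comp1 _ predn).
apply: recursive_ext (recursive_rec (@recursive_nth 1 0 isT)
  (@recursive_const 1 0) (@recursive_nth 3 0 isT)) _ => v /=.
by case: (nth 0 v 0).
Qed.

Lemma recursive_sub k F G :
  recursive k F -> recursive k G -> recursive k (fun v => F v - G v).
Proof.
apply: (@recursive_comp2 _ subn).
apply: recursive_ext (recursive_rec (@recursive_nth 2 1 isT)
  (@recursive_nth 2 0 isT) (recursive_pred (@recursive_nth 4 1 isT))) _ => v /=.
by elim: (nth 0 v 1) => [|n IHn] /=; [rewrite subn0|rewrite IHn subnS].
Qed.

Lemma recursive_exp2 k F : recursive k F -> recursive k (fun v => 2 ^ F v).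
Proof.
apply: (@recursive_comp1 _ (expn 2)).
apply: recursive_ext (recursive_rec (@recursive_nth 1 0 isT)
  (@recursive_const 1 1) (recursive_add (@recursive_nth 3 1 isT)
  (@recursive_nth 3 1 isT))) _ => v /=.
by elim: (nth 0 v 0) => [|n IHn] //=; rewrite IHn expnS mul2n addnn.
Qed.

Lemma recursive_not k (b : seq nat -> bool) :
  recursive k b -> recursive k (fun v => ~~ b v).
Proof.
move=> rb; apply: recursive_ext (recursive_sub (recursive_const k 1) rb) _ => v.
by case: (b v).
Qed.

Lemma recursive_and k (a b : seq nat -> bool) :
  recursive k a -> recursive k b -> recursive k (fun v => a v && b v).
Proof.
move=> ra rb; apply: recursive_ext (recursive_mul ra rb) _ => v.
by case: (a v); case: (b v).
Qed.

Lemma recursive_leq k F G :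
  recursive k F -> recursive k G -> recursive k (fun v => F v <= G v).
Proof.
move=> rF rG; apply: recursive_ext
  (recursive_sub (recursive_const k 1) (recursive_sub rF rG)) _ => v.
by rewrite /leq; case: (F v - G v) => [|n].
Qed.

Lemma recursive_eq k F G :
  recursive k F -> recursive k G -> recursive k (fun v => F v == G v).
Proof.
move=> rF rG; apply: recursive_ext
  (recursive_and (recursive_leq rF rG) (recursive_leq rG rF)) _ => v.
by rewrite eqn_leq.
Qed.

Lemma recursive_if k (b : seq nat -> bool) F G :
  recursive k b -> recursive k F -> recursive k G ->
  recursive k (fun v => if b v then F v else G v).
Proof.
move=> rb rF rG; apply: recursive_ext
  (recursive_add (recursive_mul rb rF) (recursive_mul (recursive_not rb) rG)) _.
by move=> v; case: (b v); rewrite /= ?mul1n ?addn0.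
Qed.

Lemma recursive_odd k F : recursive k F -> recursive k (fun v => odd (F v)).
Proof.
apply: (@recursive_comp1 _ (fun n => odd n)).
apply: recursive_ext (recursive_rec (@recursive_nth 1 0 isT)
  (@recursive_const 1 0) (recursive_sub (recursive_const _ 1)
  (@recursive_nth 3 1 isT))) _ => v /=.
by elim: (nth 0 v 0) => [|n IHn] //=; rewrite IHn; case: (odd n).
Qed.

(** The recursion uses $\lfloor (n+1)/2\rfloor = n - \lfloor n/2\rfloor$. *)
Lemma recursive_half k F : recursive k F -> recursive k (fun v => (F v)./2).
Proof.
apply: (@recursive_comp1 _ half).
apply: recursive_ext (recursive_rec (@recursive_nth 1 0 isT)
  (@recursive_const 1 0) (recursive_sub (@recursive_nth 3 0 isT)
  (@recursive_nth 3 1 isT))) _ => v /=.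
by elim: (nth 0 v 0) => [|n IHn] //=; rewrite IHn; lia.
Qed.

(** * Binary codes of finite sets *)

(** A finite set is coded by the sum of $2^x$ over its elements $x$, so that one number can carry
    the history of a construction through a primitive recursion. *)
Definition bit (x u : nat) : bool := odd (iter x half u).

Lemma recursive_bit k F G :
  recursive k F -> recursive k G -> recursive k (fun v => bit (F v) (G v)).
Proof.
apply: (@recursive_comp2 _ (fun x u => bit x u)); apply: recursive_odd.
apply: recursive_ext (recursive_rec (@recursive_nth 2 0 isT)
  (@recursive_nth 2 1 isT) (recursive_half (@recursive_nth 4 1 isT))) _ => v /=.
by elim: (nth 0 v 0) => [|n IHn] //=; rewrite IHn.
Qed.

(** This bounds the set coded by [u], so an injection must take values outside it. *)
Lemma bit_lt x u : bit x u -> x < u.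
Proof.
rewrite /bit; elim: x u => [|x IHx] u; first by case: u.
by rewrite iterSr => /IHx; lia.
Qed.

(** Digit [y] of [u] is 0, so the addition produces no carry. *)
Lemma bit_add_exp2 x y u :
  ~~ bit y u -> bit x (u + 2 ^ y) = (x == y) || bit x u.
Proof.
rewrite /bit; elim: y x u => [|y IHy] [|x] u; rewrite ?iterSr /= => bu.
- by rewrite expn0 addn1 /= bu.
- by rewrite expn0; congr (odd (iter x half _)); move: bu; lia.
- by rewrite oddD oddX addbF.
- rewrite eqSS -IHy //; congr (odd (iter x half _)).
  by rewrite expnS; lia.
Qed.

(** Pigeonhole on the [(size s).+1] distinct values of [h] at [0], ..., [size s]. The bound on [j]
    is what later keeps the greedy enumeration close to [h]. *)
Lemma inj_fresh (h : nat -> nat) (s : seq nat) :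
  injective h -> exists2 j, j <= size s & h j \notin s.
Proof.
move=> hinj; apply: contrapT => nex.
have sub : {subset [seq h j | j <- iota 0 (size s).+1] <= s}.
  move=> y /mapP[j]; rewrite mem_iota add0n ltnS => /= js ->.
  by apply: contraT => js'; case: nex; exists j.
have := uniq_leq_size _ sub; rewrite map_inj_uniq ?iota_uniq //.
by rewrite size_map size_iota ltnn => /(_ isT).
Qed.

Lemma exists_fresh_bit (h : nat -> nat) u :
  injective h -> exists j, ~~ bit (h j) u.
Proof.
move=> /(inj_fresh (iota 0 u))[j _]; rewrite mem_iota add0n => /= ju.
by exists j; apply: contra ju; exact: bit_lt.
Qed.

(** This is the least index rather than the least value; the two agree when [h] is the identity. *)
Definition fresh (h : nat -> nat) (hinj : injective h) (u : nat) : nat :=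
  ex_minn (exists_fresh_bit u hinj).

Lemma recursive_fresh h (hinj : injective h) k F :
  recursive 1 (fun v => h (nth 0 v 0)) -> recursive k F ->
  recursive k (fun v => fresh hinj (F v)).
Proof.
move=> rh; apply: recursive_comp1.
apply: (recursive_mu (recursive_bit (recursive_comp1 rh (@recursive_nth 2 0 isT))
   (@recursive_nth 2 1 isT))) => [v|v i] /=; rewrite /fresh; case: ex_minnP => j.
  by move=> /negbTE ->.
by move=> _ jmin ij; case: (boolP (bit _ _)) => // /jmin; rewrite leqNgt ij.
Qed.

(** * Square roots *)

Lemma exists_sqrt_ceil n : exists k, n <= k * k.
Proof. by exists n; case: n => // n; rewrite leq_pmulr. Qed.

Definition sqrt_ceil n := ex_minn (exists_sqrt_ceil n).

Definition is_square n : bool := sqrt_ceil n * sqrt_ceil n == n.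

Lemma recursive_is_square k F :
  recursive k F -> recursive k (fun v => is_square (F v)).
Proof.
apply: (@recursive_comp1 _ (fun n => is_square n)).
suff rs : recursive 1 (fun v => sqrt_ceil (nth 0 v 0)).
  by apply: recursive_eq (@recursive_nth 1 0 isT); exact: recursive_mul.
have r0 := @recursive_nth 2 0 isT.
apply: (recursive_mu (recursive_not
  (recursive_leq (@recursive_nth 2 1 isT) (recursive_mul r0 r0)))) => [v|v i] /=;
  rewrite /sqrt_ceil; case: ex_minnP => j; first by move=> ->.
by move=> _ jmin ij; rewrite lt0b; apply: contraL ij => /jmin; rewrite leqNgt.
Qed.

Lemma is_square_sqr n : is_square (n * n).
Proof.
rewrite /is_square /sqrt_ceil; case: ex_minnP => j nj /(_ n (leqnn _)) jn.
by rewrite eqn_leq nj leq_mul.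
Qed.

(** The rounded-up square root increases immediately after each square: if $n = i^2$, then $i$ is
    too small for $n+1$. *)
Lemma count_square n : count is_square (iota 0 n) <= sqrt_ceil n.
Proof.
elim: n => // n IHn; rewrite -addn1 iotaD count_cat /= add0n addn0 addn1.
apply: (leq_trans (leq_add IHn (leqnn _))); rewrite /is_square /sqrt_ceil.
case: ex_minnP => i ni imin; case: ex_minnP => j nj _.
have ij : i <= j by apply: imin; exact: ltnW.
case: eqP => [ii|_]; last by rewrite addn0.
by rewrite addn1 ltn_neqAle ij andbT; apply/eqP => eij; subst j; lia.
Qed.

(** Let $j$ be the rounded-up root. If $Kj > n$, then $(j-1)^2 < n < Kj$ forces $j \le K+1$, so $Kj
    \le K(K+1) \le n$, a contradiction. *)
Lemma sqrt_ceil_small K n : K * (K + 3) <= n -> K * sqrt_ceil n <= n.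
Proof.
rewrite /sqrt_ceil; case: ex_minnP => j nj /(_ j.-1) jmin Kn.
(* In the first case minimality gives [j <= j.-1], so [j] is 0. *)
case: (leqP n (j.-1 * j.-1)) => [/jmin|]; first by case: j nj {jmin} => [|j]; nia.
case: j nj jmin => [|j] nj jmin /= lt_n; first by lia.
by rewrite leqNgt; apply/negP => ltK; nia.
Qed.

(** * Extending an injection to a permutation *)

Section Greedy.
Variables (h : nat -> nat) (hinj : injective h).

(* [u] codes the values taken so far. The square stages make the enumeration
   exhaustive; all the others follow [h]. *)
Definition greedy_step (n u : nat) : nat :=
  if is_square n then fresh (@inj_id nat) u else h (fresh hinj u).

Definition greedy_used (n : nat) : nat :=
  nat_rec _ 0 (fun m u => u + 2 ^ greedy_step m u) n.

Definition greedy (n : nat) : nat := greedy_step n (greedy_used n).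

Lemma computable_greedy : computable h -> computable greedy.
Proof.
move=> /recursive1P rh; apply/recursive1P.
have rstep k F G : recursive k F -> recursive k G ->
    recursive k (fun v => greedy_step (F v) (G v)).
  move=> rF rG; apply: recursive_if; first exact: recursive_is_square.
    by apply: recursive_fresh => //; exact: recursive_nth.
  by apply: recursive_comp1 => //; exact: recursive_fresh.
apply: (rstep _ _ _ (@recursive_nth 1 0 isT)).
have r1 := @recursive_nth 3 1 isT.
exact: (recursive_rec (@recursive_nth 1 0 isT) (@recursive_const 1 0)
  (recursive_add r1 (recursive_exp2 (rstep _ _ _ (@recursive_nth 3 0 isT) r1)))).
Qed.

Lemma greedy_step_fresh n u : ~~ bit (greedy_step n u) u.
Proof. by rewrite /greedy_step /fresh; case: ifP => _; case: ex_minnP. Qed.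

(** Each stage adds a power of two with a fresh exponent, so carries never corrupt the code. *)
Lemma bit_greedy_used x n :
  bit x (greedy_used n) = (x \in [seq greedy i | i <- iota 0 n]).
Proof.
elim: n => [|n IHn]; first by apply/negP => /bit_lt.
rewrite -addn1 iotaD map_cat mem_cat /= add0n addn1 /=.
by rewrite bit_add_exp2 ?greedy_step_fresh // IHn inE orbC.
Qed.

Lemma greedy_notin n : greedy n \notin [seq greedy i | i <- iota 0 n].
Proof. by rewrite -bit_greedy_used greedy_step_fresh. Qed.

Lemma greedy_inj : injective greedy.
Proof.
have lt_neq m n : m < n -> greedy m <> greedy n.
  move=> mn e; move/negP: (greedy_notin n); apply; rewrite -e.
  by apply: map_f; rewrite mem_iota.
by move=> m n e; case: (ltngtP m n) => // /lt_neq; rewrite e.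
Qed.

Lemma greedy_surj x : exists n, greedy n = x.
Proof.
have mono m n y : m <= n -> y \in [seq greedy i | i <- iota 0 m] ->
    y \in [seq greedy i | i <- iota 0 n].
  move=> mn /mapP[i]; rewrite mem_iota => /= im ->.
  by apply: map_f; rewrite mem_iota; exact: leq_trans im mn.
have leq_sqr N : N <= N * N by case: N => // n; rewrite leq_pmulr.
suff [N /(_ x (leqnn _)) /mapP[n _ ->]] : exists N, forall y, y < x.+1 ->
    y \in [seq greedy i | i <- iota 0 N] by exists n.
elim: x.+1 => {x} [|x [N IHN]]; first by exists 0.
(* All numbers below [x] are used before stage [N], hence before the square stage [N * N], which
   takes [x] if it is still free. *)
exists (N * N).+1 => y; rewrite ltnS leq_eqVlt => /predU1P[->|/IHN]; last first.
  by apply: mono; exact: leqW.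
have [|] := boolP (x \in [seq greedy i | i <- iota 0 (N * N)]); first exact: mono.
rewrite -bit_greedy_used => xfresh.
suff <- : greedy (N * N) = x by apply: map_f; rewrite mem_iota ltnS leqnn.
rewrite /greedy /greedy_step is_square_sqr /fresh; case: ex_minnP => j jfresh.
move=> /(_ _ xfresh); rewrite leq_eqVlt => /predU1P[//|/IHN].
by move=> /(mono _ _ _ (leq_sqr N)); rewrite -bit_greedy_used (negbTE jfresh).
Qed.

(** Only [m] values are used before stage [m], so the index chosen there is at most [m]. *)
Lemma greedy_eq_inj m n :
  m < n -> ~~ is_square m -> greedy m \in [seq h j | j <- iota 0 n].
Proof.
move=> mn /negbTE msq; rewrite /greedy /greedy_step msq /fresh.
case: ex_minnP => j jfresh jmin; apply: map_f; rewrite mem_iota /=.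
have [i] := inj_fresh [seq greedy i | i <- iota 0 m] hinj.
rewrite size_map size_iota -bit_greedy_used => im /jmin ji.
exact: leq_ltn_trans (leq_trans ji im) mn.
Qed.

(** Square stages account for the error term. The values at the other stages are distinct and lie
    among those of [h] below [n]. *)
Lemma count_greedy_le (a : pred nat) n :
  count (a \o greedy) (iota 0 n) <=
  count (a \o h) (iota 0 n) + sqrt_ceil n.
Proof.
pose b := [pred m | a (greedy m) && ~~ is_square m].
have -> : count (a \o greedy) (iota 0 n) =
    count b (iota 0 n) + count [pred m | a (greedy m) && is_square m] (iota 0 n).
  by elim: (iota 0 n) => //= m s ->; case: (a _); case: (is_square m) => /=; lia.
apply: leq_add; last first.
  by apply: leq_trans (count_square n); apply: sub_count => m /andP[].
(* Lists of values are compared instead of lists of stages, since a value may occur at different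
   stages of [greedy] and [h]. *)
rewrite -!size_filter -(size_map greedy [seq m <- _ | b m]).
rewrite -(size_map h [seq m <- _ | (a \o h) m]).
apply: uniq_leq_size.
  by rewrite map_inj_uniq ?filter_uniq ?iota_uniq //; exact: greedy_inj.
move=> y /mapP[m]; rewrite mem_filter mem_iota => /andP[/andP[am msq] mn] ->.
have /mapP[j jn gE] := greedy_eq_inj mn msq.
by rewrite gE; apply: map_f; rewrite mem_filter /= -gE am.
Qed.

(** The upper bound is applied to the complement of [a]; the counts of [a] and its complement add up
    to [n]. *)
Lemma count_greedy_ge (a : pred nat) n :
  count (a \o h) (iota 0 n) <=
  count (a \o greedy) (iota 0 n) + sqrt_ceil n.
Proof.
have := count_greedy_le (predC a) n.
have := count_predC (a \o h) (iota 0 n).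
have := count_predC (a \o greedy) (iota 0 n).
have cE (f : nat -> nat) : count (predC a \o f) (iota 0 n) =
  count (predC (a \o f)) (iota 0 n) by [].
by rewrite !cE; lia.
Qed.

End Greedy.

(** * Densities *)

Section Counting.
Implicit Types (C S : set nat).

(** This counting function is both the numerator of [rho_n] and, on [C], the inverse of the
    enumeration $n \mapsto c_n$. *)
Definition rank C n := count (fun i => `[< C i >]) (iota 0 n).

Lemma rankS C n : rank C n.+1 = rank C n + `[< C n >].
Proof. by rewrite /rank -addn1 iotaD count_cat /= addn0. Qed.

Lemma leq_rank C m n : m <= n -> rank C m <= rank C n.
Proof.
move=> /subnK <-; elim: (n - m) => // k IHk.
by rewrite addSn rankS (leq_trans IHk) ?leq_addr.
Qed.

Lemma ltn_rank C m n : C m -> m < n -> rank C m < rank C n.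
Proof.
move=> Cm /(leq_rank C); rewrite rankS; move/asboolP: Cm => ->.
by rewrite addn1.
Qed.

Lemma rank_inj C m n : C m -> C n -> rank C m = rank C n -> m = n.
Proof.
move=> Cm Cn e; case: (ltngtP m n) => // [/(ltn_rank Cm)|/(ltn_rank Cn)];
  by rewrite e ltnn.
Qed.

Lemma rank_gap C m n : m <= n -> (forall x, C x -> m <= x -> n <= x) ->
  rank C n = rank C m.
Proof.
elim: n => [|n IHn]; first by rewrite leqn0 => /eqP ->.
rewrite leq_eqVlt => /predU1P[-> //|mn] gap.
rewrite rankS IHn // => [|x Cx mx]; last exact/ltnW/gap.
case: asboolP => [Cn|_]; last by rewrite addn0.
by have := gap n Cn mn; rewrite ltnn.
Qed.

Lemma rank_is_nth C n s : is_nth C n s -> C s /\ rank C s = n.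
Proof.
elim: n s => [|n IHn] s /=.
  by move=> [Cs smin]; split=> //; rewrite (@rank_gap C 0) // => x Cx _; exact: smin.
move=> [t /IHn[Ct rt] [[Cs ts] smin]]; split=> //.
rewrite (@rank_gap C t.+1) // => [|x Cx tx]; last exact: smin.
by rewrite rankS rt; move/asboolP: Ct => ->; rewrite addn1.
Qed.

Lemma infinite_unbounded C t : infinite_set C -> exists2 x, C x & t < x.
Proof.
move=> Cinf; apply: contrapT => nex; apply: Cinf.
apply: (sub_finite_set _ (finite_II t.+1)) => x Cx /=.
by rewrite ltnS leqNgt; apply/negP => tx; apply: nex; exists x.
Qed.

Lemma exists_least S x : S x -> exists s, is_least S s.
Proof.
move=> Sx; have ex : exists n, `[< S n >] by exists x; exact/asboolP.
case: (ex_minnP ex) => s /asboolP Ss smin; exists s; split=> // y Sy.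
exact/smin/asboolP.
Qed.

Lemma exists_nth C n : infinite_set C -> exists s, is_nth C n s.
Proof.
move=> Cinf; elim: n => [|n [t nt]] /=.
  by have [x Cx _] := infinite_unbounded 0 Cinf; exact: exists_least Cx.
have [x Cx tx] := infinite_unbounded t Cinf.
have [s sP] := @exists_least [set x | C x /\ t < x] x (conj Cx tx).
by exists s, t.
Qed.

Lemma is_nth_rank C s : infinite_set C -> C s -> is_nth C (rank C s) s.
Proof.
move=> Cinf Cs; have [t nt] := exists_nth (rank C s) Cinf.
by have [Ct rt] := rank_is_nth nt; have <- := rank_inj Ct Cs rt; rewrite rt.
Qed.

Lemma recursive_rank C k F :
  computable_set C -> recursive k F -> recursive k (fun v => rank C (F v)).
Proof.
move=> /recursive1P rC; apply: recursive_comp1.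
apply: recursive_ext (recursive_rec (@recursive_nth 1 0 isT)
  (@recursive_const 1 0) (recursive_add (@recursive_nth 3 1 isT)
  (recursive_comp1 rC (@recursive_nth 3 0 isT)))) _ => v /=.
by elim: (nth 0 v 0) => [|n IHn] //=; rewrite IHn rankS.
Qed.

End Counting.

(** The inverse at [x] is found by searching for the first [i] with [g i = x]. *)
Lemma computable_inverse (g p : nat -> nat) :
  cancel g p -> cancel p g -> computable g -> computable p.
Proof.
move=> gK pK /recursive1P rg; apply/recursive1P.
apply: (recursive_mu (recursive_not (recursive_eq
  (recursive_comp1 rg (@recursive_nth 2 0 isT)) (@recursive_nth 2 1 isT)))).
  by move=> v /=; rewrite pK eqxx.
move=> v i /=; case: eqP => // <-.
by rewrite gK ltnn.
Qed.

(** * Limits of relative frequencies and their stability under sublinear errors *)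

Section Density.
Variable R : realType.
Local Open Scope ring_scope.

Lemma rho_nE (S : set nat) n : rho_n R S n = (rank S n)%:R / n%:R.
Proof.
congr (_%:R / _); rewrite /rank -val_enum_ord count_map enumT.
by rewrite cardE /enum_mem size_filter; exact: eq_count.
Qed.

Lemma has_density_perturb (S T : set nat) (e : nat -> nat) (r : R) :
  (forall n, (rank S n <= rank T n + e n)%N) ->
  (forall n, (rank T n <= rank S n + e n)%N) ->
  (forall K, \forall n \near \oo, (K * e n <= n)%N) ->
  has_density S r -> has_density T r.
Proof.
move=> ST TS e0 Sr; rewrite /has_density.
have -> : (fun n => rho_n R T n) =
    (fun n => rho_n R S n) \+ (fun n => rho_n R T n - rho_n R S n).
  by apply/funext => n /=; rewrite addrCA subrr addr0.
rewrite -[r]addr0; apply: cvgD => //; apply/cvgr0Pnorm_le => eps eps0.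
(* With $K \ge 1/\varepsilon$, the bound $K e(n) \le n$ yields $e(n) \le \varepsilon n$. *)
have [K Keps] : exists K : nat, eps^-1 <= K%:R.
  by exists (Num.truncn eps^-1).+1; rewrite ltW // truncnS_gt.
near=> n.
have n0 : (0 < n)%N by near: n; exists 1%N.
have Ke : (K * e n <= n)%N by near: n; exact: e0.
rewrite !rho_nE -mulrBl normrM [X in _ * X]ger0_norm ?invr_ge0 ?ler0n //.
rewrite ler_pdivrMr ?ltr0n //.
apply: (@le_trans _ _ (e n)%:R).
  rewrite ler_norml; apply/andP; split.
    by rewrite lerNl opprB lerBlDl -natrD ler_nat.
  by rewrite lerBlDl -natrD ler_nat.
apply: (@le_trans _ _ (eps * K%:R * (e n)%:R)).
  by rewrite ler_peMl ?ler0n // -ler_pdivrMl // mulr1.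
by rewrite -mulrA ler_pM2l // -natrM ler_nat.
Unshelve. all: by end_near.
Qed.

(** This extends the defining property of intrinsic density from computable permutations to
    computable injections. *)
Lemma has_density_preimage (A : set nat) (r : R) (h : nat -> nat) :
  injective h -> computable h -> has_intrinsic_density A r ->
  has_density (h @^-1` A) r.
Proof.
move=> hinj hcomp Ar; set g := greedy hinj.
have [q qK] : {q : nat -> nat & cancel q g}.
  have /choice[q qK] : forall x, exists n, g n = x by exact: greedy_surj.
  by exists q.
have gK : cancel g q by move=> n; apply: (@greedy_inj _ hinj); exact: qK.
have qA : q @` A = g @^-1` A.
  apply/seteqP; split=> [_ [x Ax <-]|n Agn]; first by rewrite /= qK.
  by exists (g n).
apply: (@has_density_perturb (q @` A) _ sqrt_ceil).
- by move=> n; rewrite qA; exact: (count_greedy_le hinj (fun x => `[< A x >])).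
- by move=> n; rewrite qA; exact: (count_greedy_ge hinj (fun x => `[< A x >])).
- by move=> K; exists (K * (K + 3))%N => // n; exact: sqrt_ceil_small.
apply: Ar; split; first by exists g.
by apply: (computable_inverse gK qK); exact: computable_greedy.
Qed.

End Density.

(** The witness is $h(n) = c_{p^{-1}(n)}$, obtained by searching for $x \in C$ with
    $p(\mathrm{rank}(x)) = n$, a condition that can be tested by computing [p] and [rank]. *)
Lemma image_set_within (A C : set nat) (p : nat -> nat) :
  infinite_set C -> computable_set C -> computable_permutation p ->
  exists h, [/\ injective h, computable h & p @` set_within A C = h @^-1` A].
Proof.
move=> Cinf Ccomp [[p' pK p'K] pcomp].
have ex n : exists x, `[< C x >] && (p (rank C x) == n).
  have [x /rank_is_nth[Cx rx]] := exists_nth (p' n) Cinf.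
  by exists x; rewrite rx p'K eqxx andbT; exact/asboolP.
pose h n := ex_minn (ex n).
have hP n : C (h n) /\ p (rank C (h n)) = n.
  by rewrite /h; case: ex_minnP => x /andP[/asboolP Cx /eqP].
exists h; split.
- by move=> m n hmn; have [_ <-] := hP m; rewrite hmn; have [] := hP n.
- apply/recursive1P; have r0 := @recursive_nth 2 0 isT.
  have rC : recursive 2 (fun v => `[< C (nth 0 v 0) >]).
    exact: (@recursive_comp1 _ (fun n => `[< C n >]) _ (iffLR (recursive1P _) Ccomp)).
  have rp : recursive 2 (fun v => p (rank C (nth 0 v 0))).
    exact: recursive_comp1 (iffLR (recursive1P _) pcomp) (recursive_rank Ccomp r0).
  apply: (recursive_mu (recursive_not (recursive_and rC
    (recursive_eq rp (@recursive_nth 2 1 isT))))) => [v|v i] /=;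
    rewrite /h; case: ex_minnP => x.
    by move=> ->.
  move=> _ xmin ix; rewrite lt0b; apply: contraL ix => /xmin.
  by rewrite leqNgt.
apply/seteqP; split=> [_ [n [x nx Ax] <-]|n Ahn] /=.
  have [Cx rx] := rank_is_nth nx; have [Ch hn] := hP (p n).
  (* Both numbers are elements of [C] of rank [n], and [rank] is injective on [C]. *)
  suff -> : h (p n) = x by [].
  by apply: (rank_inj Ch Cx); rewrite rx; exact: (can_inj pK).
have [Ch hn] := hP n; exists (rank C (h n)) => //.
by exists (h n) => //; exact: is_nth_rank.
Qed.

Theorem theorem3p1 (R : realType) (A C : set nat) (r : R) :
  infinite_set C -> computable_set C ->
  has_intrinsic_density A r ->
  has_intrinsic_density (set_within A C) r.
Proof.
move=> Cinf Ccomp Ar p pperm.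
have [h [hinj hcomp ->]] := image_set_within A Cinf Ccomp pperm.
exact: has_density_preimage.
Qed.
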